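(* Let $m\ge 4s+1$. Then a generic $(\mathbf A,\mathbf b)\in\mathbb C^{m\times(d+1)}$ is $s$-sparse affine phase retrievable for $\mathbb C^d$.
   Context: For $\mathbf u,\mathbf v\in\mathbb C^d$, $\langle\mathbf u,\mathbf v\rangle=\sum_i\overline{u_i}v_i$. Write $(\mathbf A,\mathbf b)$ with $\mathbf A=(\mathbf a_1,\ldots,\mathbf a_m)^\top\in\mathbb C^{m\times d}$, $\mathbf b=(b_1,\ldots,b_m)^\top\in\mathbb C^m$, and $\mathbf M_{\mathbf A,\mathbf b}(\mathbf x)=(|\langle\mathbf a_1,\mathbf x\rangle+b_1|,\ldots,|\langle\mathbf a_m,\mathbf x\rangle+b_m|)$. Let $\Sigma_s(\mathbb C^d)=\{\mathbf x\in\mathbb C^d:\|\mathbf x\|_0\le s\}$ ($\|\mathbf x\|_0$ = number of nonzero entries). $(\mathbf A,\mathbf b)$ is $s$-sparse affine phase retrievable for $\mathbb C^d$ if $\mathbf M_{\mathbf A,\mathbf b}$ is injective on $\Sigma_s(\mathbb C^d)$. A property holds for generic elements of $\mathbb C^N$ if it holds on a dense open set whose complement is a null set. *)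

(* Defs.v *)
From HB Require Import structures.
From mathcomp Require Import all_boot all_order all_algebra.
From mathcomp Require Import all_classical all_reals.
From mathcomp Require Import complex.
Set Implicit Arguments. Unset Strict Implicit. Unset Printing Implicit Defensive.
Import Order.TTheory GRing.Theory Num.Theory.
Local Open Scope ring_scope.
Local Open Scope classical_set_scope.

(** * Euclidean topology and Lebesgue-null sets on R^I (I a finite index type),
      written out with sup-norm balls and countable box covers. *)
Section RealCoords.
Context {R : realType} {I : finType}.

Definition supball (x : I -> R) (r : R) : set (I -> R) :=
  [set y | forall i, `|y i - x i| < r].

Definition Ropen (S : set (I -> R)) : Prop :=
  forall x, S x -> exists2 r : R, 0 < r & supball x r `<=` S.

Definition Rdense (S : set (I -> R)) : Prop :=
  forall x (r : R), 0 < r -> exists y, supball x r y /\ S y.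

Definition Rnull (S : set (I -> R)) : Prop :=
  forall eps : R, 0 < eps ->
  exists lo hi : nat -> I -> R,
    (forall k i, lo k i <= hi k i) /\
    (S `<=` \bigcup_k [set y | forall i, lo k i <= y i <= hi k i]) /\
    (forall n, \sum_(k < n) \prod_(i : I) (hi k i - lo k i) < eps).

Definition Rgeneric (P : (I -> R) -> Prop) : Prop :=
  exists U : set (I -> R), [/\ Ropen U, Rdense U, Rnull (~` U) & U `<=` P].
End RealCoords.

Definition mx_coords {R : realType} {m n : nat} (M : 'M[R[i]]_(m, n))
  : ('I_m * 'I_n * bool) -> R :=
  fun k => let: (i, j, b) := k in if b then @complex.Re R (M i j) else @complex.Im R (M i j).

Definition Cgeneric {R : realType} {m n : nat} (P : 'M[R[i]]_(m, n) -> Prop) : Prop :=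
  exists U : set ('I_m * 'I_n * bool -> R),
    [/\ Ropen U, Rdense U, Rnull (~` U) & forall M, U (mx_coords M) -> P M].

Local Open Scope complex_scope.

Definition cinner {R : realType} {d : nat} (u v : 'I_d -> R[i]) : R[i] :=
  \sum_(j < d) (u j)^* * v j.

Definition l0 {R : realType} {d : nat} (x : 'I_d -> R[i]) : nat :=
  #|[set j | x j != 0]|.

Definition sparse_vecs {R : realType} {d : nat} (s : nat) : set ('I_d -> R[i]) :=
  [set x | (l0 x <= s)%N].

Definition affine_meas {R : realType} {m d : nat}
  (A : 'M[R[i]]_(m, d)) (b : 'I_m -> R[i]) (x : 'I_d -> R[i]) : 'I_m -> R[i] :=
  fun k => `| cinner (fun j => A k j) x + b k |.

Definition sparse_affine_PR {R : realType} {m d : nat} (s : nat)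
  (A : 'M[R[i]]_(m, d)) (b : 'I_m -> R[i]) : Prop :=
  forall x y, sparse_vecs s x -> sparse_vecs s y ->
    affine_meas A b x = affine_meas A b y -> x = y.

(** (A, b) packed as an m x (d+1) matrix: first d columns are A, last is b. *)
Definition Apart {R : realType} {m d : nat} (M : 'M[R[i]]_(m, d.+1)) : 'M[R[i]]_(m, d) :=
  \matrix_(k, j) M k (widen_ord (leqnSn d) j).
Definition bpart {R : realType} {m d : nat} (M : 'M[R[i]]_(m, d.+1)) : 'I_m -> R[i] :=
  fun k => M k ord_max.

(* Main.v *)
Require Import Defs.
From HB Require Import structures.
From mathcomp Require Import all_boot all_order all_algebra.
From mathcomp Require Import all_classical all_reals.
From mathcomp Require Import complex.
From mathcomp Require Import ring lra zify.
Set Implicit Arguments. Unset Strict Implicit. Unset Printing Implicit Defensive.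
Import Order.TTheory GRing.Theory Num.Theory.
Local Open Scope ring_scope.
Local Open Scope classical_set_scope.
Local Open Scope complex_scope.

(* If [(A, b)] is not injective on sparse vectors, there are sparse [x <> y] such
   that, with [u = x - y], every row satisfies
   [Re (<a_k, u> * conj (<a_k, x + y> + 2 b_k)) = 0].  Thus either
   [<a_k, u> = 0], or [2 b_k = - <a_k, x + y> + i r_k <a_k, u>] with [r_k] real.
   Either way row [k] loses at least one real parameter, while the pair [(x, y)]
   adds at most [4 s] of them once its supports are fixed.  Since [m > 4 s], the
   bad pairs [(A, b)] lie in finitely many images of polynomial maps into
   [R^(2m(d+1))] from a space of smaller dimension.  Counting monomials, each
   image is contained in the zero set of a nonzero polynomial, and such a zero
   set is closed, nowhere dense and null. *)

(** * Real polynomial functions in finitely many variables *)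

Section PolynomialFunctions.
Context {R : realType} {J : finType}.
Implicit Types (F G : (J -> R) -> R) (z : J -> R).

(** Bounding each exponent separately makes the monomials a finite type with [(N+1)^#|J|] elements,
    the number that the dimension count compares. *)
Definition pev (N : nat) (c : {ffun J -> 'I_N.+1} -> R) z : R :=
  \sum_a c a * \prod_j z j ^+ a j.

Definition polyfun_le (N : nat) F := exists c, F =1 @pev N c.

Definition polyfun F := exists N, polyfun_le N F.

Lemma eq_polyfun_le N F G : F =1 G -> polyfun_le N G -> polyfun_le N F.
Proof. by move=> FG [c Gc]; exists c => z; rewrite FG Gc. Qed.

Lemma polyfun_le_add N F G : polyfun_le N F -> polyfun_le N G ->
  polyfun_le N (fun z => F z + G z).
Proof.
move=> [c Fc] [c' Gc]; exists (fun a => c a + c' a) => z.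
by rewrite Fc Gc /pev -big_split; apply: eq_bigr => a _; rewrite mulrDl.
Qed.

Lemma polyfun_le_scale N k F : polyfun_le N F -> polyfun_le N (fun z => k * F z).
Proof.
move=> [c Fc]; exists (fun a => k * c a) => z.
by rewrite Fc /pev mulr_sumr; apply: eq_bigr => a _; rewrite mulrA.
Qed.

Lemma polyfun_le_monomial N (g : J -> nat) : (forall j, g j <= N)%N ->
  polyfun_le N (fun z => \prod_j z j ^+ g j).
Proof.
move=> gN; pose a0 : {ffun J -> 'I_N.+1} := [ffun j => inord (g j)].
exists (fun a => (a == a0)%:R) => z; rewrite /pev (bigD1 a0) //= eqxx mul1r.
rewrite [X in _ + X]big1 ?addr0 => [|a /negPf->]; last by rewrite mul0r.
by apply: eq_bigr => j _; rewrite ffunE inordK // ltnS.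
Qed.

Lemma polyfun_le_cst N k : polyfun_le N (fun=> k).
Proof.
apply: (@eq_polyfun_le _ _ (fun z => k * \prod_j z j ^+ 0)) => [z|].
  by rewrite big1 ?mulr1 // => j _; rewrite expr0.
exact/polyfun_le_scale/(@polyfun_le_monomial N (fun=> 0%N)).
Qed.

Lemma polyfun_le_sum N (T : finType) (F : T -> (J -> R) -> R) :
  (forall t, polyfun_le N (F t)) -> polyfun_le N (fun z => \sum_t F t z).
Proof.
move=> FN; elim: (index_enum T) => [|t r IH].
  by apply: (eq_polyfun_le _ (polyfun_le_cst N 0)) => z; rewrite big_nil.
by apply: (eq_polyfun_le _ (polyfun_le_add (FN t) IH)) => z; rewrite big_cons.
Qed.

Lemma polyfun_le_mul N N' F G : polyfun_le N F -> polyfun_le N' G ->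
  polyfun_le (N + N') (fun z => F z * G z).
Proof.
move=> [c Fc] [c' Gc].
apply: (@eq_polyfun_le _ _ (fun z => \sum_a \sum_b
   (c a * c' b) * \prod_j z j ^+ (a j + b j))) => [z|].
  rewrite Fc Gc /pev mulr_suml; apply: eq_bigr => a _; rewrite mulr_sumr.
  apply: eq_bigr => b _; rewrite mulrACA -big_split /=.
  by congr (_ * _); apply: eq_bigr => j _; rewrite exprD.
do 2 apply: polyfun_le_sum => ?.
apply/polyfun_le_scale/polyfun_le_monomial => j.
by rewrite leq_add // -ltnS ltn_ord.
Qed.

Lemma polyfun_le_exp N F k : polyfun_le N F -> polyfun_le (k * N) (fun z => F z ^+ k).
Proof.
move=> FN; elim: k => [|k IH].
  by apply: (eq_polyfun_le _ (polyfun_le_cst _ 1)) => z; rewrite expr0.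
rewrite mulSn.
by apply: (eq_polyfun_le _ (polyfun_le_mul FN IH)) => z; rewrite exprS.
Qed.

Lemma polyfun_le_leq N N' F : (N <= N')%N -> polyfun_le N F -> polyfun_le N' F.
Proof.
move=> le_N [c Fc]; apply: (eq_polyfun_le Fc); apply: polyfun_le_sum => a.
apply/polyfun_le_scale/polyfun_le_monomial => j.
by rewrite (leq_trans _ le_N) // -ltnS ltn_ord.
Qed.

Lemma polyfun_le_prod (T : finType) (N : T -> nat) (F : T -> (J -> R) -> R) :
  (forall t, polyfun_le (N t) (F t)) ->
  polyfun_le (\sum_t N t) (fun z => \prod_t F t z).
Proof.
move=> FN; elim: (index_enum T) => [|t r IH].
  rewrite big_nil.
  by apply: (eq_polyfun_le _ (polyfun_le_cst 0 1)) => z; rewrite big_nil.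
rewrite big_cons.
by apply: (eq_polyfun_le _ (polyfun_le_mul (FN t) IH)) => z; rewrite big_cons.
Qed.

Lemma polyfun_cst k : polyfun (fun=> k).
Proof. by exists 0%N; apply: polyfun_le_cst. Qed.

Lemma polyfun_var j : polyfun (fun z => z j).
Proof.
exists 1%N; apply: (@eq_polyfun_le _ _ (fun z => \prod_i z i ^+ (i == j))) => [z|].
  rewrite (bigD1 j) //= eqxx expr1 big1 ?mulr1 // => i /negPf->.
  by rewrite expr0.
by apply: polyfun_le_monomial => i; case: (i == j).
Qed.

Lemma polyfun_add F G : polyfun F -> polyfun G -> polyfun (fun z => F z + G z).
Proof.
move=> [N FN] [N' GN]; exists (N + N')%N; apply: polyfun_le_add.
  exact: polyfun_le_leq (leq_addr _ _) FN.
exact: polyfun_le_leq (leq_addl _ _) GN.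
Qed.

Lemma polyfun_mul F G : polyfun F -> polyfun G -> polyfun (fun z => F z * G z).
Proof. by move=> [N FN] [N' GN]; exists (N + N')%N; apply: polyfun_le_mul. Qed.

Lemma polyfun_opp F : polyfun F -> polyfun (fun z => - F z).
Proof.
move=> [N FN]; exists N.
by apply: (eq_polyfun_le _ (polyfun_le_scale (-1) FN)) => z; rewrite mulN1r.
Qed.

End PolynomialFunctions.

(** * Algebraic dependence of more polynomials than variables *)

Section AlgebraicDependence.
Context {R : realType}.

(** A matrix with more rows than columns has a nonzero left kernel. *)
Lemma linear_dependence (T S : finType) (M : T -> S -> R) : (#|S| < #|T|)%N ->
  exists2 c : T -> R, (exists t, c t != 0) & forall s, \sum_t c t * M t s = 0.
Proof.
move=> ltST; pose A := \matrix_(t < #|T|, s < #|S|) M (enum_val t) (enum_val s).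
have : kermx A != 0.
  rewrite -mxrank_eq0 mxrank_ker subn_eq0 -ltnNge.
  exact: leq_ltn_trans (rank_leq_col A) ltST.
case/rowV0Pn => v /sub_kermxP vA v0.
exists (fun t => v 0 (enum_rank t)) => [|s].
  case/matrix0Pn: v0 => i [j vij]; exists (enum_val j).
  by rewrite enum_valK; rewrite (ord1 i) in vij.
have /matrixP/(_ 0 (enum_rank s)) := vA; rewrite !mxE => vA0; rewrite -[RHS]vA0.
rewrite [LHS](reindex _ (onW_bij _ (@enum_val_bij T))) /=.
apply: eq_bigr => t _; by rewrite !mxE enum_valK enum_rankK.
Qed.

(* Composing the monomials of box degree at most [k] with [f] gives [(k+1)^#|I|]
   elements of a space of dimension [(#|I| k e + 1)^#|J|], where [e] bounds the
   degrees of the [f i]; for large [k] the former number is larger. *)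
Lemma algebraic_dependence (I J : finType) (f : I -> (J -> R) -> R) :
  (#|J| < #|I|)%N -> (forall i, polyfun (f i)) ->
  exists (N : nat) (c : {ffun I -> 'I_N.+1} -> R), (exists a, c a != 0) /\
    forall z, pev c (fun i => f i z) = 0.
Proof.
move=> ltJI /choice [deg degf].
pose e := (\sum_i deg i)%N.
have fe i : polyfun_le e (f i).
  by apply: polyfun_le_leq (degf i); rewrite /e (bigD1 i) //= leq_addr.
(* With [k = B^n] and [K + 1 <= (k+1) B], one gets [(K+1)^n <= (k+1)^n k < (k+1)^(n+1) <=
   (k+1)^D]. *)
set D := #|I|; set n := #|J|; pose B := (D * e).+1; pose k := (B ^ n)%N.
pose K := (D * (k * e))%N.
have ltK : (K.+1 ^ n < k.+1 ^ D)%N.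
  have le1 : (K.+1 ^ n <= (k.+1 * B) ^ n)%N.
    have [->|n0] := posnP n; first by rewrite !expn0.
    rewrite leq_exp2r // /K /B mulSn mulnS addSn ltnS mulnCA.
    by rewrite (leq_trans _ (leq_addl _ _)) // leq_addl.
  apply: leq_ltn_trans le1 _; rewrite expnMn -/k.
  apply: (@leq_trans (k.+1 ^ n.+1)%N); last by rewrite leq_exp2l // ltnS expn_gt0.
  by rewrite expnS mulnC ltn_pmul2r ?expn_gt0.
have /choice [M MP] (a : {ffun I -> 'I_k.+1}) :
    polyfun_le K (fun z : J -> R => \prod_i f i z ^+ a i).
  apply: (@polyfun_le_leq _ _ (\sum_i (a i * e))%N); last first.
    by apply: polyfun_le_prod => i; apply: polyfun_le_exp.
  rewrite /K /D -sum_nat_const leq_sum // => i _.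
  by rewrite leq_mul2r -ltnS ltn_ord orbT.
have [|c c0 cM] := @linear_dependence {ffun I -> 'I_k.+1} {ffun J -> 'I_K.+1} M.
  by rewrite !card_ffun !card_ord.
exists k, c; split=> // z.
transitivity (\sum_b (\sum_a c a * M a b) * \prod_j z j ^+ (b : {ffun J -> 'I_K.+1}) j).
  under [RHS]eq_bigr do rewrite mulr_suml.
  rewrite exchange_big; apply: eq_bigr => a _.
  rewrite MP /pev mulr_sumr; apply: eq_bigr => b _; exact: mulrA.
by rewrite big1 // => b _; rewrite cM mul0r.
Qed.

End AlgebraicDependence.

(** * Countable unions and finite covers of null sets *)

Section NullSets.
Context {R : realType} {I : finType}.
Implicit Types (S T : set (I -> R)).

Lemma Rnull_sub S T : S `<=` T -> Rnull T -> Rnull S.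
Proof.
move=> ST nT eps e0; have [lo [hi [le_lh [cov vol]]]] := nT eps e0.
by exists lo, hi; split=> //; split=> //; apply: subset_trans ST cov.
Qed.

Lemma prod_diff_ge0 (lo hi : I -> R) : (forall i, lo i <= hi i) ->
  0 <= \prod_i (hi i - lo i).
Proof. by move=> le_lh; apply: prodr_ge0 => i _; rewrite subr_ge0. Qed.

(** Bounds the volume of a cover enumerated through pair codes. [A] exceeds both coordinates of
    every pair coded below [n], and distinct codes decode to distinct pairs, so each term occurs in
    the square. *)
Lemma sum_pickle_le (g : nat * nat -> R) (n : nat) : (forall x, 0 <= g x) ->
  exists A : nat, \sum_(k < n) oapp g 0 (pickle_inv k)
               <= \sum_(a < A) \sum_(b < A) g (val a, val b).
Proof.
move=> g0; pose s (k : nat) := oapp (fun x : nat * nat => x.1 + x.2)%N 0%N (pickle_inv k).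
pose A := (\sum_(k < n) s k).+1; exists A.
pose h (x : 'I_A * 'I_A) := (val x.1, val x.2).
rewrite pair_big /=.
have -> : \sum_(k < n) oapp g 0 (pickle_inv k) =
    \sum_(k < n) \sum_(x : 'I_A * 'I_A) (pickle (h x) == k)%:R * g (h x).
  apply: eq_bigr => k _; case E: (pickle_inv k) => [x|] /=; last first.
    rewrite big1 // => x _; case: eqP => [xk|_]; last by rewrite mul0r.
    by rewrite -xk pickleK_inv in E.
  have xk : pickle x = k by have := @pickle_invK (nat * nat)%type k; rewrite E.
  have sx : (x.1 + x.2 < A)%N.
    rewrite /A ltnS (bigD1 k) //=; apply: leq_trans (leq_addr _ _).
    by rewrite /s E.
  have lt1 : (x.1 < A)%N by apply: leq_ltn_trans sx; rewrite leq_addr.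
  have lt2 : (x.2 < A)%N by apply: leq_ltn_trans sx; rewrite leq_addl.
  rewrite (bigD1 (Ordinal lt1, Ordinal lt2)) //= /h /= -surjective_pairing xk eqxx mul1r.
  rewrite big1 ?addr0 // => y yne; case: eqP => [yk|_]; last by rewrite mul0r.
  case/eqP: yne; move: yk; rewrite -xk => /(pcan_inj (@pickleK_inv (nat * nat)%type)).
  by case: y x {E sx xk} lt1 lt2 => y1 y2 [x1 x2] lt1 lt2 [e1 e2]; congr pair; apply: val_inj.
rewrite exchange_big /=; apply: ler_sum => x _; rewrite -mulr_suml.
rewrite -[leRHS]mul1r ler_wpM2r //.
have [lt|ge] := ltnP (pickle (h x)) n.
  rewrite (bigD1 (Ordinal lt)) //= eqxx big1 ?addr0 // => k.
  by rewrite -val_eqE /= eq_sym => /negPf->.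
rewrite big1 // => k _; case: eqP => // E.
by move: ge; rewrite leqNgt E ltn_ord.
Qed.

Lemma sum_geometric_half (n : nat) : \sum_(k < n) (2^-1 : R) ^+ k.+1 = 1 - 2^-1 ^+ n.
Proof.
elim: n => [|n IH]; first by rewrite big_ord0 expr0 subrr.
by rewrite big_ord_recr /= IH !exprS; field.
Qed.

(* Boxes of volume zero, available because [I] is inhabited, fill the indices
   of [nat] that do not encode a pair. *)
Lemma Rnull_bigcup (i0 : I) (S : nat -> set (I -> R)) : (forall n, Rnull (S n)) ->
  Rnull (\bigcup_n S n).
Proof.
move=> nS eps e0.
have /choice [lo /choice [hi H]] : forall n, exists lo hi : nat -> I -> R,
    (forall k i, lo k i <= hi k i) /\
    (S n `<=` \bigcup_k [set y | forall i, lo k i <= y i <= hi k i]) /\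
    (forall m, \sum_(k < m) \prod_(i : I) (hi k i - lo k i) < eps * 2^-1 ^+ n.+1).
  by move=> n; apply: nS; rewrite mulr_gt0 // exprn_gt0 // invr_gt0.
pose g (b : nat -> nat -> I -> R) (x : nat * nat) := b x.1 x.2.
pose lo' k := oapp (g lo) (fun=> 0) (pickle_inv k).
pose hi' k := oapp (g hi) (fun=> 0) (pickle_inv k).
exists lo', hi'; split=> [k i|]; last split=> [z [n _ Sz]|m].
- rewrite /lo' /hi'; case: pickle_inv => [[n l]|] //=; exact: (H n).1.
- have [_ [cov _]] := H n; have [k _ zk] := cov z Sz.
  by exists (pickle (n, k)) => //= i; rewrite /lo' /hi' pickleK_inv /=; apply: zk.
pose v (x : nat * nat) := \prod_i (hi x.1 x.2 i - lo x.1 x.2 i).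
have [|A le_A] := @sum_pickle_le v m.
  by move=> x; apply: prod_diff_ge0 => i; exact: (H x.1).1.
apply: (@le_lt_trans _ _ (\sum_(k < m) oapp v 0 (pickle_inv k))).
  apply: ler_sum => k _; rewrite /lo' /hi'; case: pickle_inv => [x|] //=.
  by rewrite (bigD1 i0) //= subrr mul0r.
apply: le_lt_trans le_A _.
apply: (@le_lt_trans _ _ (\sum_(a < A) eps * 2^-1 ^+ a.+1)).
  by apply: ler_sum => a _; apply/ltW; exact: (H a).2.2.
rewrite -mulr_sumr sum_geometric_half -[ltRHS]mulr1 ltr_pM2l //.
by rewrite ltrBlDr ltrDl exprn_gt0 // invr_gt0.
Qed.

(** The finite family is continued by the degenerate box at the origin, which has volume zero
    because [I] is inhabited. *)
Lemma Rnull_finite_cover (i0 : I) S :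
  (forall eps : R, 0 < eps -> exists (T : finType) (lo hi : T -> I -> R),
    [/\ forall t i, lo t i <= hi t i,
        forall z, S z -> exists t, forall i, lo t i <= z i <= hi t i &
        \sum_t \prod_i (hi t i - lo t i) < eps]) ->
  Rnull S.
Proof.
move=> fS eps e0; have [T [lo [hi [le_lh cov vol]]]] := fS eps e0.
pose g (b : T -> I -> R) (k : nat) := oapp (fun j : 'I_#|T| => b (enum_val j)) (fun=> 0) (insub k).
exists (g lo), (g hi); split=> [k i|]; last split=> [z Sz|n].
- by rewrite /g; case: insub => [j|] //=.
- have [t tz] := cov z Sz; exists (val (enum_rank t)) => //= i.
  by rewrite /g valK /= enum_rankK.
apply: le_lt_trans vol; rewrite [leRHS](reindex _ (onW_bij _ (@enum_val_bij T))) /=.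
pose w (k : nat) := \prod_i (g hi k i - g lo k i).
have w0 k : 0 <= w k.
  by apply: prod_diff_ge0 => i; rewrite /g; case: insub => [j|] //=.
have wz k : (#|T| <= k)%N -> w k = 0.
  by move=> ge; rewrite /w (bigD1 i0) //= /g insubF ?ltnNge ?ge //= subrr mul0r.
have -> : \sum_(j < #|T|) \prod_i (hi (enum_val j) i - lo (enum_val j) i) =
   \sum_(j < #|T|) w j.
  by apply: eq_bigr => j _; rewrite /w /g valK.
rewrite -!(big_mkord xpredT w) /index_iota !subn0.
have [le|gt] := leqP n #|T|.
  rewrite -(subnKC le) iotaD big_cat /= lerDl; apply: sumr_ge0 => k _; exact: w0.
rewrite -(subnKC (ltnW gt)) iotaD big_cat /= add0n [X in _ + X]big1_seq ?addr0 //.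
by move=> k /andP[_]; rewrite mem_iota => /andP[ge _]; apply: wz.
Qed.

End NullSets.

(** * Thinness of a zero set, from that of its leading coefficient *)

Section ZeroSets.
Context {R : realType}.

(* The [r l] are the real parts of the complex roots. *)
Lemma small_value_near_root (e : nat) (a : nat -> R) : a e != 0 ->
  exists r : 'I_e -> R, forall t tau : R, 0 < tau ->
    `|\sum_(j < e.+1) a j * t ^+ j| < `|a e| * tau ^+ e ->
    exists l, `|t - r l| <= tau.
Proof.
move=> ae0; pose p := \poly_(j < e.+1) a j.
have sp : size p = e.+1 by rewrite size_poly_eq.
have lp : lead_coef p = a e by rewrite lead_coefE sp coef_poly ltnSn.
have [rs defq] := closed_field_poly_normal (map_poly (real_complex R) p).
have lq : lead_coef (map_poly (real_complex R) p) = (a e)%:C%C.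
  by rewrite lead_coef_map lp.
have srs : size rs = e.
  have := congr1 (fun q : {poly _} => size q) defq.
  rewrite size_map_poly sp size_scale ?size_prod_XsubC => [[->]//|].
  by rewrite lq fmorph_eq0.
exists (fun l => complex.Re (nth 0 rs l)) => t tau tau0.
apply: contraPP => /forallNP far; apply/negP; rewrite -leNgt.
have pt : (p.[t])%:C%C = (a e)%:C%C * \prod_(z <- rs) (t%:C%C - z).
  rewrite -[LHS](horner_map (real_complex R)) defq hornerZ lq horner_prod.
  by congr (_ * _); apply: eq_bigr => z _; rewrite !hornerE.
have nR (x : R) : `|x%:C%C| = (`|x|)%:C%C :> R[i].
  by rewrite normc_def /= expr0n addr0 sqrtr_sqr.
(* Each factor satisfies [|t - z| >= |t - Re z|], which exceeds [tau] for every root when [t] is far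
   from all the real parts. *)
have : `|(p.[t])%:C%C| >= (`|a e| * tau ^+ e)%:C%C :> R[i].
  rewrite pt normrM nR rmorphM; apply: ler_wpM2l; first by rewrite lecR.
  rewrite normr_prod rmorphXn /= -srs (big_nth 0) big_mkord -[X in _ ^+ X]card_ord.
  rewrite -prodr_const; apply: ler_prod => l _; rewrite lecR ltW //=.
  apply: le_trans (normc_ge_Re _); rewrite lecR.
  have l_e : (l < e)%N by rewrite -srs.
  have /negP := far (Ordinal l_e); rewrite -ltNge /= => /ltW.
  by case: (nth 0 rs l).
by rewrite nR lecR horner_poly.
Qed.

Context {I : finType}.
Implicit Types (F G : (I -> R) -> R) (z w : I -> R).

(** Lipschitz continuity on cubes for the sup norm. The bound [h] stands in for the distance, so
    that no maximum over [I] is formed. *)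
Definition lip_bounded F := forall L : R, 0 <= L -> exists2 C : R, 0 <= C &
  forall z w h, (forall i, `|z i| <= L) -> (forall i, `|w i| <= L) ->
    0 <= h -> (forall i, `|z i - w i| <= h) -> `|F z - F w| <= C * h.

Lemma lip_bounded_cst k : lip_bounded (fun=> k).
Proof. by move=> L L0; exists 0 => // *; rewrite subrr normr0 mul0r. Qed.

Lemma lip_bounded_var i : lip_bounded (fun z => z i).
Proof. by move=> L L0; exists 1 => // z w h _ _ _ H; rewrite mul1r. Qed.

Lemma lip_bounded_add F G : lip_bounded F -> lip_bounded G ->
  lip_bounded (fun z => F z + G z).
Proof.
move=> lF lG L L0; have [C C0 HC] := lF L L0; have [D D0 HD] := lG L L0.
exists (C + D); rewrite ?addr_ge0 // => z w h zL wL h0 zw.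
rewrite opprD addrACA mulrDl (le_trans (ler_normD _ _)) //.
by rewrite lerD ?HC ?HD.
Qed.

Lemma lip_bounded_bound F (L : R) : lip_bounded F -> 0 <= L ->
  exists2 B : R, 0 <= B & forall z, (forall i, `|z i| <= L) -> `|F z| <= B.
Proof.
move=> lF L0; have [C C0 HC] := lF L L0.
exists (`|F (fun=> 0)| + C * L) => [|z zL]; first by rewrite addr_ge0 ?mulr_ge0.
rewrite -[F z](subrK (F (fun=> 0))) addrC (le_trans (ler_normD _ _)) // lerD2l.
by apply: HC => // i; rewrite ?normr0 // subr0.
Qed.

Lemma lip_bounded_mul F G : lip_bounded F -> lip_bounded G ->
  lip_bounded (fun z => F z * G z).
Proof.
move=> lF lG L L0; have [C C0 HC] := lF L L0; have [D D0 HD] := lG L L0.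
have [A A0 HA] := lip_bounded_bound lF L0; have [B B0 HB] := lip_bounded_bound lG L0.
exists (A * D + C * B); rewrite ?addr_ge0 ?mulr_ge0 // => z w h zL wL h0 zw.
have -> : F z * G z - F w * G w = F z * (G z - G w) + (F z - F w) * G w by ring.
rewrite [leRHS]mulrDl (le_trans (ler_normD _ _)) // !normrM lerD //.
  by rewrite -mulrA ler_pM ?HA ?HD.
by rewrite mulrAC ler_pM ?HB ?HC.
Qed.

Lemma lip_bounded_pev N (c : {ffun I -> 'I_N.+1} -> R) : lip_bounded (pev c).
Proof.
rewrite /pev; elim: (index_enum _) => [|a r IH].
  by under eq_fun do rewrite big_nil; apply: lip_bounded_cst.
under eq_fun do rewrite big_cons; apply: lip_bounded_add => //.
apply: lip_bounded_mul; first exact: lip_bounded_cst.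
elim: (index_enum I) => [|i s IHs].
  by under eq_fun do rewrite big_nil; apply: lip_bounded_cst.
under eq_fun do rewrite big_cons; apply: lip_bounded_mul => //.
elim: (nat_of_ord (a i)) => [|n IHn].
  by under eq_fun do rewrite expr0; apply: lip_bounded_cst.
under eq_fun do rewrite exprS; apply: lip_bounded_mul => //.
exact: lip_bounded_var.
Qed.

Lemma Ropen_nonzero F : lip_bounded F -> Ropen [set z | F z != 0].
Proof.
move=> lF x Fx; pose L := \sum_i `|x i| + 1.
have L0 : 0 <= L by rewrite addr_ge0 // sumr_ge0.
have [C C0 HC] := lF L L0.
(* Radius at most 1 keeps the ball in the cube of size [L]; the other bound gives [C r < |F x|], so
   [F] cannot drop to zero. The [+ 1] guards against [C = 0]. *)
pose r := Num.min 1 (`|F x| / (2 * (C + 1))).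
have nF : 0 < `|F x| by rewrite normr_gt0.
have r0 : 0 < r by rewrite lt_min ltr01 divr_gt0 // mulr_gt0 // ltr_wpDl.
exists r => // y yx /=; apply/eqP => Fy.
have xi i : `|x i| <= \sum_i `|x i|.
  by rewrite (bigD1 i) //= lerDl sumr_ge0.
have : `|F x - F y| <= C * r.
  apply: HC; [| |exact: ltW|] => i.
  - by rewrite (le_trans (xi i)) // lerDl.
  - rewrite -(subrK (x i) (y i)) addrC (le_trans (ler_normD _ _)) // lerD //.
    by rewrite (le_trans (ltW (yx i))) // ge_min lexx.
  - by rewrite distrC ltW //; apply: yx.
rewrite Fy subr0; apply/negP; rewrite -ltNge.
apply: (@le_lt_trans _ _ (C * (`|F x| / (2 * (C + 1))))).
  by rewrite ler_wpM2l // ge_min lexx orbT.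
rewrite mulrA ltr_pdivrMr ?mulr_gt0 ?ltr_wpDl //; nra.
Qed.

Lemma grid_cell (L : R) (M : nat) (t : R) : 0 < L -> (0 < M)%N -> `|t| <= L ->
  exists k : 'I_M, - L + k%:R * (2 * L / M%:R) <= t <= - L + k.+1%:R * (2 * L / M%:R).
Proof.
case: M => // M L0 _ tL; set h := 2 * L / _.
have h0 : 0 < h by rewrite divr_gt0 ?mulr_gt0.
have [t1 t2] : - L <= t /\ t <= L by move: tL; rewrite ler_norml => /andP.
have q0 : 0 <= (t + L) / h by rewrite divr_ge0 ?(ltW h0) //; lra.
have /andP[q1 q2] := truncn_itv q0; set n := Num.trunc _ in q1 q2.
have [ltn|gen] := ltnP n M.+1.
  exists (Ordinal ltn) => /=; move: q1 q2; rewrite ler_pdivlMr // ltr_pdivrMr //.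
  lra.
(* The truncation reaches the number of cells only at [t = L], which belongs to the last closed
   cell. *)
exists ord_max => /=; have hM : M.+1%:R * h = 2 * L by rewrite mulrC divfK ?pnatr_eq0.
apply/andP; split; last by rewrite hM; lra.
move: q1; rewrite ler_pdivlMr // => q1.
have : M%:R * h <= n%:R * h by rewrite ler_pM2r // ler_nat ltnW.
lra.
Qed.

(** A Fubini argument by boxes. Where [a e] stays away from zero, fixing the other coordinates up to
    a small cell confines [z i] to within [tau] of [e] real numbers. The boxes so obtained have
    total volume proportional to [tau]. *)
Lemma Rnull_leading_coef (F : (I -> R) -> R) (i : I) (e : nat)
    (a : nat -> (I -> R) -> R) :
  lip_bounded F ->
  (forall z, F z = \sum_(j < e.+1) a j z * z i ^+ j) ->
  (forall j z t, a j (dfwith z i t) = a j z) ->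
  Rnull [set z | a e z = 0] -> Rnull [set z | F z = 0].
Proof.
move=> lF defF ai nae.
(* The zero set is exhausted by bounded pieces on which [|a e|] is bounded below; index 0 of [S]
   takes the zeros of [a e]. *)
pose Z (n : nat) := [set z | [/\ forall k, `|z k| <= n.+1%:R,
   n.+1%:R^-1 <= `|a e z| & F z = 0]].
pose S n := if n is k.+1 then Z k else [set z | a e z = 0].
apply: (@Rnull_sub _ _ _ (\bigcup_n S n)) => [z Fz|].
  have [ae0|ae0] := eqVneq (a e z) 0; first by exists 0%N.
  pose n := Num.trunc (\sum_k `|z k| + `|a e z|^-1).
  have := truncnS_gt (\sum_k `|z k| + `|a e z|^-1); rewrite -/n => /ltW ltn.
  have sum0 : 0 <= \sum_k `|z k| by rewrite sumr_ge0.
  have inv0 : 0 < `|a e z|^-1 by rewrite invr_gt0 normr_gt0.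
  exists n.+1 => //; split=> // [k|].
    apply: le_trans ltn; rewrite (bigD1 k) //= -addrA lerDl addr_ge0 ?sumr_ge0 //.
    exact: ltW.
  rewrite -[leRHS]invrK lef_pV2 ?posrE ?ltr0n //.
  by apply: le_trans ltn; rewrite lerDr.
apply: (Rnull_bigcup i) => -[//|n]; rewrite /S.
apply: (Rnull_finite_cover i) => eps eps0.
set L : R := n.+1%:R; have L0 : 0 < L by rewrite ltr0n.
have [C C0 HC] := lF L (ltW L0).
(* [V * tau] will be the total volume of the cover: [e] intervals of length [2 tau], times a cube of
   side [2 L] in the other coordinates. *)
pose V := e%:R * (2 * L) ^+ #|I|.-1 * 2.
have V0 : 0 <= V by rewrite !mulr_ge0 // exprn_ge0 // mulr_ge0 // ltW.
pose tau := eps / (V + 1).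
have tau0 : 0 < tau by rewrite divr_gt0 // ltr_wpDl.
have Vtau : V * tau < eps.
  by rewrite /tau mulrCA -[ltRHS]mulr1 ltr_pM2l // ltr_pdivrMr ?mul1r ?ltrDl ?ltr_wpDl.
(* Fine enough that the variation [C h] of [F] across a cell is below [L^-1 tau^e], the threshold of
   [small_value_near_root] when [|a e| >= L^-1]. *)
pose M := (Num.trunc (C * (2 * L) / (L^-1 * tau ^+ e))).+1.
pose h := 2 * L / M%:R.
have h0 : 0 < h by rewrite divr_gt0 ?mulr_gt0 ?ltr0n.
have Ch : C * h < L^-1 * tau ^+ e.
  rewrite /h mulrA ltr_pdivrMr ?ltr0n // [ltRHS]mulrC -ltr_pdivrMr; last first.
    by rewrite mulr_gt0 ?invr_gt0 ?exprn_gt0.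
  exact: truncnS_gt.
pose cell (k : {ffun I -> 'I_M}) z := forall l, l != i ->
  - L + (k l)%:R * h <= z l <= - L + (k l).+1%:R * h.
(* One reference point [x] of the cell supplies the polynomial in one variable whose roots serve
   every zero [z] of the cell: its value at [z i] is [F y - F z] with [y] within [h] of [z]. A cell
   that misses [Z n] gets a dummy value. *)
have /choice [r Hr] : forall k : {ffun I -> 'I_M}, exists r : 'I_e -> R,
    forall z, Z n z -> cell k z -> exists l, `|z i - r l| <= tau.
  move=> k; have [[x [Zx cx]]|nx] := pselect (exists x, Z n x /\ cell k x); last first.
    by exists (fun=> 0) => z Zz cz; case: nx; exists z.
  case: (Zx) => xL aex _.
  have ae0 : a e x != 0.
    by rewrite -normr_gt0 (lt_le_trans _ aex) // invr_gt0 ltr0n.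
  have [r Hr] := @small_value_near_root e (a^~ x) ae0; exists r => z [zL _ Fz] cz.
  apply: Hr => //; apply: lt_le_trans (_ : L^-1 * tau ^+ e <= _); last first.
    by rewrite ler_pM2r ?exprn_gt0.
  apply: le_lt_trans Ch.
  pose y := dfwith x i (z i).
  have -> : \sum_(j < e.+1) a j x * z i ^+ j = F y - F z.
    rewrite Fz subr0 defF; apply: eq_bigr => j _.
    by rewrite /y ai dfwithin.
  apply: HC => // [l||l]; last 1 first.
  - rewrite /y; case: dfwithP => [|l' ne]; first by rewrite subrr normr0 ltW.
    rewrite eq_sym in ne; have := cx _ ne; have := cz _ ne.
    rewrite ler_norml -natr1 mulrDl; lra.
  - by rewrite /y; case: dfwithP.
  - exact: ltW.
(* Cells are indexed by functions on all of [I], with a redundant value at [i]. Only the index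
   [ord0] there carries an interval; the others give boxes of width zero, so nothing is counted
   twice. *)
pose lo (t : {ffun I -> 'I_M} * 'I_e) l : R :=
  if l == i then if t.1 l == ord0 then r t.1 t.2 - tau else 0
  else - L + (t.1 l)%:R * h.
pose hi (t : {ffun I -> 'I_M} * 'I_e) l : R :=
  if l == i then if t.1 l == ord0 then r t.1 t.2 + tau else 0
  else - L + (t.1 l).+1%:R * h.
exists ({ffun I -> 'I_M} * 'I_e)%type, lo, hi; split=> [t l|z Zz|].
- rewrite /lo /hi; case: ifP => _; last by rewrite lerD2l ler_pM2r // ler_nat.
  by case: ifP => // _; lra.
- case: (Zz) => zL _ _.
  have /choice [k Hk] l := @grid_cell L M (z l) L0 isT (zL l).
  pose k' := [ffun l => if l == i then ord0 else k l].
  have ck : cell k' z by move=> l ne; rewrite ffunE (negPf ne); apply: Hk.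
  have [l Hl] := Hr _ _ Zz ck; exists (k', l) => j; rewrite /lo /hi /=.
  case: eqP => [->|/eqP ne]; last exact: ck.
  by rewrite ffunE eqxx /=; move: Hl; rewrite ler_distl; lra.
apply: le_lt_trans Vtau.
rewrite -(pair_big xpredT xpredT (fun k l => \prod_i0 (hi (k, l) i0 - lo (k, l) i0))) /=.
pose W l (v : 'I_M) : R := if l == i then (if v == ord0 then 2 * tau else 0) else h.
have -> : \sum_k \sum_l \prod_j (hi (k, l) j - lo (k, l) j) =
   \sum_(k : {ffun I -> 'I_M}) e%:R * \prod_j W j (k j).
  apply: eq_bigr => k _; rewrite -[e in RHS]card_ord mulr_natl -sumr_const.
  apply: eq_bigr => l _; apply: eq_bigr => j _; rewrite /hi /lo /W /=.
  case: eqP => _; first by case: eqP => _; ring.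
  by rewrite -natr1; ring.
(* The sum over cells factors by coordinate: [2 tau] at [i], and [M h = 2 L] at each other one. *)
rewrite -mulr_sumr -(bigA_distr_bigA W) (bigD1 i) //=.
have -> : \sum_j W i j = 2 * tau.
  rewrite /W eqxx (bigD1 ord0) //= big1 ?addr0 // => v /negPf->; by [].
rewrite (eq_bigr (fun=> 2 * L)) => [|l ne]; last first.
  rewrite /W (negPf ne) sumr_const card_ord -[LHS]mulr_natr.
  by rewrite /h divfK // pnatr_eq0.
rewrite prodr_const.
have -> : #|[pred l | l != i]| = #|I|.-1 by rewrite -(cardC1 i); apply: eq_card.
by rewrite /V le_eqVlt; apply/orP; left; apply/eqP; ring.
Qed.

(** After a move to [y] with [a e y != 0], the polynomial in coordinate [i] has degree exactly [e],
    so it cannot vanish at all [e + 1] points [x i + r / (k + 2)], which lie strictly within [r] of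
    [x i]. *)
Lemma Rdense_leading_coef (F : (I -> R) -> R) (i : I) (e : nat)
    (a : nat -> (I -> R) -> R) :
  (forall z, F z = \sum_(j < e.+1) a j z * z i ^+ j) ->
  (forall j z t, a j (dfwith z i t) = a j z) ->
  Rdense [set z | a e z != 0] -> Rdense [set z | F z != 0].
Proof.
move=> defF ai dae x r r0; have [y [yx /= ae0]] := dae x r r0.
pose p := \poly_(j < e.+1) a j y.
have sp : size p = e.+1 by rewrite size_poly_eq.
have p0 : p != 0 by rewrite -size_poly_eq0 sp.
pose pt (k : nat) := x i + r / k.+2%:R.
have inj_pt : injective pt.
  move=> k l /addrI /(mulfI (lt0r_neq0 r0)) /invr_inj /eqP.
  by rewrite eqr_nat => /eqP [].
have [|] := boolP (all (root p) (mkseq pt e.+1)).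
  move=> rts; have := max_poly_roots p0 rts (mkseq_uniq e.+1 inj_pt).
  by rewrite size_mkseq sp ltnn.
case/allPn => t /mapP[k _ ->] nroot; exists (dfwith y i (pt k)); split=> [l|/=].
  case: dfwithP => [|l' _]; last exact: yx.
  rewrite /pt addrAC subrr add0r gtr0_norm ?divr_gt0 //.
  by rewrite ltr_pdivrMr ?ltr0n // -[ltLHS]mulr1 ltr_pM2l // ltr1n.
move: nroot; rewrite /root horner_poly defF; apply: contraNN => /eqP {2}<-.
by apply/eqP; apply: eq_bigr => j _; rewrite ai dfwithin.
Qed.

End ZeroSets.

(** * Nonvanishing of a nonzero polynomial is generic; stability of genericity *)

Section Generic.
Context {R : realType} {I : finType}.
Implicit Types (z : I -> R).

Section Slices.
Variable N : nat.
Implicit Types (a : {ffun I -> 'I_N.+1}) (c : {ffun I -> 'I_N.+1} -> R).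

Definition exp_upd a (i : I) (j : 'I_N.+1) : {ffun I -> 'I_N.+1} :=
  [ffun k => if k == i then j else a k].

(** The coefficient of the [j]-th power of variable [i], kept as a polynomial in all variables with
    exponent zero at [i], so that the induction on variables stays in one type. *)
Definition coef_slice (i : I) (j : 'I_N.+1) c : {ffun I -> 'I_N.+1} -> R :=
  fun a => if a i == ord0 then c (exp_upd a i j) else 0.

Lemma pev_slices i c z : pev c z = \sum_j pev (coef_slice i j c) z * z i ^+ j.
Proof.
rewrite /pev (partition_big (fun a => a i) xpredT) //=; apply: eq_bigr => j _.
rewrite (reindex_onto (fun a => exp_upd a i j) (fun a => exp_upd a i ord0)); last first.
  move=> a /eqP aij; apply/ffunP => k; rewrite !ffunE.
  by case: eqP => // ->.
rewrite mulr_suml big_mkcond; apply: eq_bigr => a _; rewrite /coef_slice.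
have -> : (exp_upd a i j i == j) && (exp_upd (exp_upd a i j) i ord0 == a) = (a i == ord0).
  rewrite ffunE !eqxx /=; apply/eqP/eqP => [<-|ai0]; first by rewrite ffunE eqxx.
  by apply/ffunP => k; rewrite !ffunE; case: eqP => // ->.
case: eqP => [ai0|_]; last by rewrite !mul0r.
rewrite -mulrA; congr (_ * _); rewrite (bigD1 i) //= ffunE eqxx.
rewrite [in RHS](bigD1 i) //= ai0 expr0 mul1r mulrC; congr (_ * _).
by apply: eq_bigr => k /negPf ne; rewrite ffunE ne.
Qed.

Lemma pev_slice_dfwith i j c z t :
  pev (coef_slice i j c) (dfwith z i t) = pev (coef_slice i j c) z.
Proof.
apply: eq_bigr => a _; rewrite /coef_slice; case: eqP => [ai0|_]; last by rewrite !mul0r.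
congr (_ * _); apply: eq_bigr => k _.
by case: dfwithP => [|//]; rewrite ai0 !expr0.
Qed.

(** Induction on a set [A] containing the variables that occur: the leading coefficient in one of
    them is a nonzero polynomial in the rest. With no variable left, the polynomial is a nonzero
    constant. *)
Lemma pev_zero_set_thin (i0 : I) c : (exists a, c a != 0) ->
  Rdense [set z | pev c z != 0] /\ Rnull [set z | pev c z = 0].
Proof.
move=> c0; have [n] := ubnP #|[set: I]%SET|.
have : forall a i, c a != 0 -> i \notin [set: I]%SET -> a i = ord0.
  by move=> a i _; rewrite inE.
elim: n [set: I]%SET c c0 => // n IH A c [a0 ca0] supp ltA.
have [A0|[i iA]] := set_0Vmem A.
  have pevc z : pev c z = c a0.
    rewrite /pev (bigD1 a0) //= [X in _ * X]big1 ?mulr1 => [|i _]; last first.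
      by rewrite supp ?A0 ?inE.
    rewrite big1 ?addr0 // => a ne; have [->|ca] := eqVneq (c a) 0; first by rewrite mul0r.
    case/eqP: ne; apply/ffunP => i; by rewrite !supp ?A0 ?inE.
  split=> [x r r0|]; first by exists x; split=> [l|/=]; rewrite ?subrr ?normr0 ?pevc.
  apply: (Rnull_finite_cover i0) => eps e0; exists void, (fun=> fun=> 0), (fun=> fun=> 0).
  split=> [//|z /= /eqP|]; first by rewrite pevc (negPf ca0).
  by rewrite big1 // => -[].
(* A monomial of largest exponent in variable [i]: its exponent is the degree [e], and it witnesses
   that the leading coefficient is nonzero. *)
have [a1 ca1 maxa1] := @arg_maxnP _ a0 (fun a => c a != 0) (fun a => nat_of_ord (a i)) ca0.
pose e : nat := a1 i; pose co (j : nat) z := pev (coef_slice i (inord j) c) z.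
have eN : (e <= N)%N by rewrite -ltnS ltn_ord.
have defc z : pev c z = \sum_(j < e.+1) co j z * z i ^+ j.
  rewrite (pev_slices i); transitivity (\sum_(j < N.+1) co j z * z i ^+ j).
    by apply: eq_bigr => j _; rewrite /co inord_val.
  rewrite -!(big_mkord xpredT (fun j => co j z * z i ^+ j)).
  rewrite (big_cat_nat (n := e.+1)) //= [X in _ + X]big_nat_cond [X in _ + X]big1 ?addr0 //.
  move=> j /andP[/andP[ltej ltjN] _]; rewrite /co /pev big1 ?mul0r // => a _.
  rewrite /coef_slice; case: eqP => _; last by rewrite mul0r.
  have [->|ne] := eqVneq (c (exp_upd a i (inord j))) 0; first by rewrite mul0r.
  by move: (maxa1 _ ne); rewrite ffunE eqxx inordK //= leqNgt ltej.
have co_i j z t : co j (dfwith z i t) = co j z by exact: pev_slice_dfwith.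
have [] := IH (A :\ i)%SET (coef_slice i (inord e) c).
- exists (exp_upd a1 i ord0); rewrite /coef_slice ffunE !eqxx.
  suff -> : exp_upd (exp_upd a1 i ord0) i (inord e) = a1 by [].
  apply/ffunP => k; rewrite !ffunE; case: eqP => // ->.
  by rewrite inord_val.
- move=> a k; rewrite /coef_slice; case: (a i =P ord0) => [ai0|]; last by rewrite eqxx.
  move=> ca; rewrite !inE negb_and negbK => /orP[/eqP->//|kA].
  have := supp _ k ca kA; rewrite ffunE; case: eqP => [->//|//].
- by move: ltA; rewrite (cardsD1 i A) iA.
move=> dn nl; split.
  exact: (Rdense_leading_coef defc co_i dn).
exact: (Rnull_leading_coef (lip_bounded_pev c) defc co_i nl).
Qed.

End Slices.

Lemma Rgeneric_pev_neq0 (i0 : I) N (c : {ffun I -> 'I_N.+1} -> R) :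
  (exists a, c a != 0) -> Rgeneric (fun z => pev c z != 0).
Proof.
move=> c0; have [dn nl] := pev_zero_set_thin i0 c0.
exists [set z | pev c z != 0]; split=> //.
  exact/Ropen_nonzero/lip_bounded_pev.
by apply: Rnull_sub nl => z /= /negP; rewrite negbK => /eqP.
Qed.

Lemma Rgeneric_weaken (P Q : (I -> R) -> Prop) :
  (forall z, P z -> Q z) -> Rgeneric P -> Rgeneric Q.
Proof. by move=> PQ [U [oU dU nU UP]]; exists U; split=> // z /UP /PQ. Qed.

Lemma Rgeneric_true (i0 : I) : Rgeneric (fun z : I -> R => True).
Proof.
exists setT; split=> //.
- by move=> x _; exists 1 => //.
- by move=> x r r0; exists x; split=> // i; rewrite subrr normr0.
apply: (Rnull_finite_cover i0) => eps e0; exists void, (fun=> fun=> 0), (fun=> fun=> 0).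
by split=> [//|z /(_ Logic.I)//|]; rewrite big1 // => -[].
Qed.

(** Density survives because [U] is open: a point of [U] near [x] can be moved into [V] without
    leaving [U]. *)
Lemma Rgeneric_and (i0 : I) (P Q : (I -> R) -> Prop) :
  Rgeneric P -> Rgeneric Q -> Rgeneric (fun z => P z /\ Q z).
Proof.
move=> [U [oU dU nU UP]] [V [oV dV nV VQ]]; exists (U `&` V); split.
- move=> x [Ux Vx]; have [r r0 rU] := oU x Ux; have [s s0 sV] := oV x Vx.
  exists (Num.min r s); first by rewrite lt_min r0.
  move=> y yx; split; [apply: rU|apply: sV] => i;
    by have := yx i; rewrite lt_min => /andP[].
- move=> x r r0; have r2 : 0 < r / 2 by rewrite divr_gt0.
  have [y [yx Uy]] := dU x _ r2; have [s s0 sU] := oU y Uy.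
  have [|w [wy Vw]] := dV y (Num.min s (r / 2)); first by rewrite lt_min s0.
  exists w; split=> [i|].
    rewrite -(subrK (y i) (w i)) -addrA (le_lt_trans (ler_normD _ _)) //.
    rewrite [ltRHS]splitr; apply: ltrD; last exact: yx.
    by have := wy i; rewrite lt_min => /andP[].
  by split=> //; apply: sU => i; have := wy i; rewrite lt_min => /andP[].
- apply: (@Rnull_sub _ _ _ (\bigcup_n (if n is 0%N then ~` U else ~` V))).
    move=> z nUV; have [Uz|nUz] := pselect (U z); last by exists 0%N.
    by exists 1%N => // Vz; apply: nUV.
  by apply: (Rnull_bigcup i0) => -[|n].
by move=> z [/UP Pz /VQ Qz].
Qed.

Lemma Rgeneric_forall (i0 : I) (T : finType) (P : T -> (I -> R) -> Prop) :
  (forall t, Rgeneric (P t)) -> Rgeneric (fun z => forall t, P t z).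
Proof.
move=> gP; suff : Rgeneric (fun z => forall t, t \in enum T -> P t z).
  by apply: Rgeneric_weaken => z Pz t; apply: Pz; rewrite mem_enum.
elim: (enum T) => [|t r IH]; first exact: Rgeneric_weaken (Rgeneric_true i0).
apply: Rgeneric_weaken (Rgeneric_and i0 (gP t) IH) => z [Pt Pr] t'.
by rewrite inE => /orP[/eqP->//|/Pr].
Qed.

(** The image of [f] lies in the zero set of the polynomial relation between its components. *)
Lemma Rgeneric_avoid_polyfun (i0 : I) (J : finType) (f : I -> (J -> R) -> R) :
  (#|J| < #|I|)%N -> (forall i, polyfun (f i)) ->
  Rgeneric (fun w => forall z : J -> R, w <> (fun i => f i z)).
Proof.
move=> ltJI pf; have [N [c [c0 cf]]] := algebraic_dependence ltJI pf.
apply: Rgeneric_weaken (Rgeneric_pev_neq0 i0 c0) => w cw z wz.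
by move: cw; rewrite wz cf eqxx.
Qed.

End Generic.

(** * Complex-valued functions with polynomial real and imaginary parts *)

Section ComplexPolynomialFunctions.
Context {R : realType} {J : finType}.
Implicit Types (F G : (J -> R) -> R[i]) (z : J -> R).

Definition cpolyfun F :=
  polyfun (fun z => complex.Re (F z)) /\ polyfun (fun z => complex.Im (F z)).

Lemma eq_polyfun (f g : (J -> R) -> R) : f =1 g -> polyfun g -> polyfun f.
Proof. by move=> fg [N gN]; exists N; apply: eq_polyfun_le gN. Qed.

Lemma cpolyfun_cst k : cpolyfun (fun=> k).
Proof. by split; apply: polyfun_cst. Qed.

Lemma cpolyfun_real f : polyfun f -> cpolyfun (fun z => (f z)%:C).
Proof. by split=> //=; apply: polyfun_cst. Qed.

Lemma cpolyfun_slot (j k : J) : cpolyfun (fun z => z j +i* z k).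
Proof. by split; apply: polyfun_var. Qed.

Lemma cpolyfun_add F G : cpolyfun F -> cpolyfun G -> cpolyfun (fun z => F z + G z).
Proof.
move=> [F1 F2] [G1 G2]; split;
  [apply: eq_polyfun (polyfun_add F1 G1)|apply: eq_polyfun (polyfun_add F2 G2)];
  by move=> z; case: (F z) (G z) => [? ?] [].
Qed.

Lemma cpolyfun_opp F : cpolyfun F -> cpolyfun (fun z => - F z).
Proof.
move=> [F1 F2]; split;
  [apply: eq_polyfun (polyfun_opp F1)|apply: eq_polyfun (polyfun_opp F2)];
  by move=> z; case: (F z).
Qed.

Lemma cpolyfun_conj F : cpolyfun F -> cpolyfun (fun z => (F z)^*).
Proof.
move=> [F1 F2]; split;
  [apply: eq_polyfun F1|apply: eq_polyfun (polyfun_opp F2)];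
  by move=> z; case: (F z).
Qed.

Lemma cpolyfun_mul F G : cpolyfun F -> cpolyfun G -> cpolyfun (fun z => F z * G z).
Proof.
move=> [F1 F2] [G1 G2]; split.
  apply: eq_polyfun (polyfun_add (polyfun_mul F1 G1) (polyfun_opp (polyfun_mul F2 G2))).
  by move=> z; case: (F z) (G z) => [? ?] [].
apply: eq_polyfun (polyfun_add (polyfun_mul F1 G2) (polyfun_mul F2 G1)).
by move=> z; case: (F z) (G z) => [? ?] [].
Qed.

Lemma cpolyfun_sum (T : Type) (r : seq T) (P : pred T) (F : T -> (J -> R) -> R[i]) :
  (forall t, cpolyfun (F t)) -> cpolyfun (fun z => \sum_(t <- r | P t) F t z).
Proof.
move=> pF; elim: r => [|t r IH].
  by under eq_fun do rewrite big_nil; apply: cpolyfun_cst.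
under eq_fun do rewrite big_cons; case: (P t) => //.
exact: cpolyfun_add.
Qed.

End ComplexPolynomialFunctions.

(** * Equal moduli, inverses and sparse vectors *)

Section Complex.
Context {R : realType}.

(** [|p|^2 - |q|^2] is the real part of [(p + q) (p - q)^*], so [p + q] is orthogonal to [p - q] in
    the real plane. The factor [r] is the imaginary part of that product divided by [|p - q|^2]. *)
Lemma equal_modulus_phase (p q : R[i]) : `|p| = `|q| -> p != q ->
  exists r : R, p + q = 'i * r%:C * (p - q).
Proof.
move=> /(congr1 (fun x => complex.Re (x ^+ 2))); rewrite !sqr_normc.
case: p q => [p1 p2] [q1 q2] /= pq.
rewrite eq_complex /= -subr_eq0 -[X in _ && X]subr_eq0 => pq0.
pose w1 := p1 - q1; pose w2 := p2 - q2.
have n0 : w1 ^+ 2 + w2 ^+ 2 != 0.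
  by rewrite paddr_eq0 ?sqr_ge0 // !sqrf_eq0.
have orth : (p1 + q1) * w1 + (p2 + q2) * w2 = 0.
  by rewrite /w1 /w2; lra.
exists (((p2 + q2) * w1 - (p1 + q1) * w2) / (w1 ^+ 2 + w2 ^+ 2)).
apply/eqP; rewrite eq_complex /= -/w1 -/w2; apply/andP; split; apply/eqP.
  apply: (mulIf n0); transitivity ((p1 + q1) * w1 * w1 + (p1 + q1) * w2 * w2); first by ring.
  have -> : (p1 + q1) * w1 = - ((p2 + q2) * w2) by lra.
  by field.
apply: (mulIf n0); transitivity ((p2 + q2) * w2 * w2 + (p2 + q2) * w1 * w1); first by ring.
have -> : (p2 + q2) * w2 = - ((p1 + q1) * w1) by lra.
by field.
Qed.

(** Makes division by [u] polynomial, at the price of one extra real parameter [1 / |u|^2]. *)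
Lemma real_mul_conj_inv (u : R[i]) : u != 0 ->
  exists r : R, r%:C * u^* * u = 1.
Proof.
case: u => a b; rewrite eq_complex /= => ab0; exists (a ^+ 2 + b ^+ 2)^-1.
have n0 : a ^+ 2 + b ^+ 2 != 0.
  by rewrite paddr_eq0 ?sqr_ge0 // !sqrf_eq0.
by apply/eqP; rewrite eq_complex /=; apply/andP; split; apply/eqP; field.
Qed.

(** Splits a sparse vector into finitely many choices of positions [sg] and [2 s] real parameters.
    Surplus slots hold the value 0 at the default position [j0]. *)
Lemma sparse_slots (d s : nat) (j0 : 'I_d) (x : 'I_d -> R[i]) : sparse_vecs s x ->
  exists (sg : {ffun 'I_s -> 'I_d}) (xi : 'I_s -> R[i]),
    forall j, x j = \sum_l (sg l == j)%:R * xi l.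
Proof.
rewrite /sparse_vecs /l0 /= => xs; pose S := enum [set j | x j != 0]%SET.
have sS : (size S <= s)%N.
  rewrite -cardE (leq_trans _ xs) // subset_leq_card //; apply/fintype.subsetP => j.
  by rewrite inE => xj; apply: mem_set.
exists [ffun l : 'I_s => nth j0 S l], (fun l => if (l < size S)%N then x (nth j0 S l) else 0).
move=> j; have [jS|jS] := boolP (j \in S); last first.
  rewrite big1 => [|l _]; last first.
    rewrite ffunE; case: ifP => [lS|_]; last by rewrite mulr0.
    by case: eqP => [E|_]; [rewrite -E mem_nth in jS|rewrite mul0r].
  by apply/eqP; move: jS; rewrite mem_enum inE negbK.
have lS : (index j S < size S)%N by rewrite index_mem.
rewrite (bigD1 (Ordinal (leq_trans lS sS))) //= ffunE /= nth_index // eqxx lS mul1r.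
rewrite big1 ?addr0 // => l ne; rewrite ffunE; case: ifP => [lS'|_]; last by rewrite mulr0.
case: eqP => [E|_]; last by rewrite mul0r.
by case/eqP: ne; apply: val_inj; rewrite /= -E index_uniq // enum_uniq.
Qed.

End Complex.

(** * Polynomial parametrization of the bad pairs *)

(* Rows [k] outside [K] satisfy [2 b_k = - <a_k, x + y> + i r_k <a_k, x - y>].
   For [k] in [K] the row satisfies [<a_k, x - y> = 0], which is solved for the
   entry [j0]; the slot of that entry then stores [b_k], and the slot of
   [r_k0], unused when [k0] is in [K], stores [1 / |x_j0 - y_j0|^2]. *)
Section Parametrization.
Context {R : realType} (m d s : nat).

(** In order: slot values of [x], slot values of [y], one complex number per entry of [A], and one
    real number per row; [true] marks real parts. *)
Definition params : finType :=
  (('I_s * bool) + ('I_s * bool) + ('I_m * 'I_d * bool) + 'I_m)%type.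

Variables (sg ta : {ffun 'I_s -> 'I_d}) (K : {set 'I_m}) (k0 : 'I_m) (j0 : 'I_d).
Implicit Types (z : params -> R) (k : 'I_m) (j : 'I_d).

Definition par_x z j : R[i] := \sum_l (sg l == j)%:R *
  (z (inl (inl (inl (l, true)))) +i* z (inl (inl (inl (l, false))))).

Definition par_y z j : R[i] := \sum_l (ta l == j)%:R *
  (z (inl (inl (inr (l, true)))) +i* z (inl (inl (inr (l, false))))).

Definition par_u z j : R[i] := par_x z j - par_y z j.

Definition par_slot z k j : R[i] :=
  z (inl (inr (k, j, true))) +i* z (inl (inr (k, j, false))).

(** The outer conjugation undoes the one that [cinner] applies to its first argument. *)
Definition par_A z k j : R[i] :=
  if (k \in K) && (j == j0) then
    (- ((z (inr k0))%:C * (par_u z j0)^* *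
        \sum_(i | i != j0) (par_slot z k i)^* * par_u z i))^*
  else par_slot z k j.

Definition par_b z k : R[i] :=
  if k \in K then par_slot z k j0 else
    2^-1 * (- cinner (par_slot z k) (fun j => par_x z j + par_y z j)
            + 'i * (z (inr k))%:C * cinner (par_slot z k) (par_u z)).

Definition par_mx z : 'M[R[i]]_(m, d.+1) :=
  \matrix_(k, j) if insub (val j) is Some j' then par_A z k j' else par_b z k.

(** The count is [4 s + 2 m d + m < 2 m (d + 1)], that is, [4 s < m]. *)
Lemma card_params : (4 * s + 1 <= m)%N ->
  (#|params| < #|{: 'I_m * 'I_d.+1 * bool}|)%N.
Proof.
rewrite /params !card_sum !card_prod !card_ord !card_bool mulnS => ?; nia.
Qed.

Lemma cpolyfun_par_u j : cpolyfun (par_u ^~ j).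
Proof.
apply: cpolyfun_add; [|apply: cpolyfun_opp]; apply: cpolyfun_sum => l;
  apply: cpolyfun_mul; by [apply: cpolyfun_cst|apply: cpolyfun_slot].
Qed.

Lemma cpolyfun_par_v j : cpolyfun (fun z => par_x z j + par_y z j).
Proof.
apply: cpolyfun_add; apply: cpolyfun_sum => l;
  apply: cpolyfun_mul; by [apply: cpolyfun_cst|apply: cpolyfun_slot].
Qed.

Lemma cpolyfun_cinner (F G : (params -> R) -> 'I_d -> R[i]) :
  (forall j, cpolyfun (F ^~ j)) -> (forall j, cpolyfun (G ^~ j)) ->
  cpolyfun (fun z => cinner (F z) (G z)).
Proof.
move=> pF pG; apply: cpolyfun_sum => j.
by apply: cpolyfun_mul => //; apply: cpolyfun_conj.
Qed.

Lemma cpolyfun_par_mx k (j : 'I_d.+1) : cpolyfun (fun z => par_mx z k j).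
Proof.
have pslot k' i : cpolyfun (fun z => par_slot z k' i) by apply: cpolyfun_slot.
under eq_fun do rewrite mxE.
case: insub => [j'|]; rewrite /par_A /par_b; [case: andb|case: (k \in K)] => //.
  apply/cpolyfun_conj/cpolyfun_opp/cpolyfun_mul.
    apply: cpolyfun_mul; first exact/cpolyfun_real/polyfun_var.
    exact/cpolyfun_conj/cpolyfun_par_u.
  apply: cpolyfun_sum => i; apply: cpolyfun_mul; first exact: cpolyfun_conj.
  exact: cpolyfun_par_u.
apply: cpolyfun_mul; first exact: cpolyfun_cst.
apply: cpolyfun_add.
  apply: cpolyfun_opp; apply: cpolyfun_cinner => //; exact: cpolyfun_par_v.
apply: cpolyfun_mul; last by apply: cpolyfun_cinner => //; exact: cpolyfun_par_u.
apply: cpolyfun_mul; first exact: cpolyfun_cst.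
exact/cpolyfun_real/polyfun_var.
Qed.

Lemma polyfun_par_coords t : polyfun (fun z => mx_coords (par_mx z) t).
Proof.
by case: t => [[k j] []]; have [pRe pIm] := cpolyfun_par_mx k j.
Qed.

End Parametrization.

(** * Every non-injective pair is parametrized, and the conclusion *)

Lemma non_injective_parametrized (R : realType) (m d s : nat) (M : 'M[R[i]]_(m, d.+1)) :
  (0 < m)%N -> ~ sparse_affine_PR s (Apart M) (bpart M) ->
  exists (sg ta : {ffun 'I_s -> 'I_d}) (K : {set 'I_m}) (k0 : 'I_m) (j0 : 'I_d) z,
    M = par_mx sg ta K k0 j0 z.
Proof.
move=> m0 /existsNP[x /existsNP[y /not_implyP[xs /not_implyP[ys /not_implyP[eqM neq]]]]].
set A := Apart M in eqM; set b := bpart M in eqM.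
have /existsNP[j0 /eqP xy0] : ~ forall j, x j = y j by move=> E; apply: neq; apply/funext.
have [sg [xi defx]] := sparse_slots j0 xs.
have [ta [eta defy]] := sparse_slots j0 ys.
pose u j := x j - y j.
have u0 : u j0 != 0 by rewrite subr_eq0.
have [rho rhoE] := real_mul_conj_inv u0.
pose K := [set k | cinner (A k) u == 0]%SET.
have cinnerB k : cinner (A k) u = cinner (A k) x - cinner (A k) y.
  by rewrite /cinner -sumrB; apply: eq_bigr => j _; rewrite mulrBr.
have cinnerD k : cinner (A k) (fun j => x j + y j) = cinner (A k) x + cinner (A k) y.
  by rewrite /cinner -big_split; apply: eq_bigr => j _; rewrite mulrDr.
(* Here [p] and [q] are the measurements of [x] and [y] before taking moduli, with
   [p - q = <a_k, u>]. For [k] in [K] the claim is vacuous and [r] takes the value 0. *)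
have /choice [r Hr] : forall k, exists r : R, k \notin K ->
    cinner (A k) (fun j => x j + y j) + 2 * b k = 'i * r%:C * cinner (A k) u.
  move=> k; rewrite inE cinnerB subr_eq0.
  have [E|ne] := eqVneq (cinner (A k) x) (cinner (A k) y); first by exists 0.
  have ne' : cinner (A k) x + b k != cinner (A k) y + b k by rewrite (inj_eq (addIr _)).
  have /= := congr1 (fun f => f k) eqM; rewrite /affine_meas => /equal_modulus_phase.
  move=> /(_ ne')[r rE]; exists r => _; rewrite cinnerD.
  have -> : cinner (A k) x - cinner (A k) y =
    (cinner (A k) x + b k) - (cinner (A k) y + b k) by ring.
  by rewrite -rE; ring.
(* [k0] lies in [K] whenever [K] is inhabited, so its real slot is free to store [rho]; otherwise
   any row will do. *)
have [k0 Hk0] : exists k0, forall k, k \in K -> k0 \in K.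
  have [K0|[k kK]] := set_0Vmem K; last by exists k.
  by exists (Ordinal m0) => k; rewrite K0 inE.
pose sl k j := if (k \in K) && (j == j0) then b k else A k j.
pose z (p : params m d s) : R := match p with
  | inl (inl (inl (l, t))) => if t then complex.Re (xi l) else complex.Im (xi l)
  | inl (inl (inr (l, t))) => if t then complex.Re (eta l) else complex.Im (eta l)
  | inl (inr (k, j, t)) => if t then complex.Re (sl k j) else complex.Im (sl k j)
  | inr k => if k \in K then rho else r k
  end.
have eta_complex (c : R[i]) : complex.Re c +i* complex.Im c = c by case: c.
have zx j : par_x sg z j = x j.
  by rewrite defx /par_x; apply: eq_bigr => l _; rewrite eta_complex.
have zy j : par_y ta z j = y j.
  by rewrite defy /par_y; apply: eq_bigr => l _; rewrite eta_complex.
have zu j : par_u sg ta z j = u j by rewrite /par_u zx zy.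
have zs k j : par_slot z k j = sl k j by rewrite /par_slot eta_complex.
exists sg, ta, K, k0, j0, z; apply/matrixP => k j; rewrite mxE.
case: insubP => [j' _ jE|]; last first.
  rewrite -leqNgt => dj; have -> : j = ord_max.
    by apply: val_inj; apply/eqP; rewrite eqn_leq dj -ltnS ltn_ord.
  rewrite -/(bpart M k) -/b /par_b zs /sl eqxx andbT.
  case: ifP => [->//|/negbT kK].
  have Es : par_slot z k = A k by apply/funext => i; rewrite zs /sl (negPf kK).
  have -> : par_u sg ta z = u by apply/funext.
  have -> : (fun i => par_x sg z i + par_y ta z i) = (fun i => x i + y i).
    by apply/funext => i; rewrite zx zy.
  by rewrite Es /z (negPf kK) -Hr //; field.
have -> : M k j = A k j'.
  by rewrite /A mxE; congr (M k _); apply: val_inj; rewrite /= -jE.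
rewrite /par_A; case: ifP => [/andP[kK /eqP->]|kj]; last by rewrite zs /sl kj.
have -> : z (inr k0) = rho by rewrite /z (Hk0 _ kK).
(* For [k] in [K], [<a_k, u> = 0], so the terms off [j0] sum to minus the term at [j0]. *)
rewrite zu; have -> : \sum_(i | i != j0) (par_slot z k i)^* * par_u sg ta z i =
    - ((A k j0)^* * u j0).
  apply/eqP; rewrite -addr_eq0 addrC; apply/eqP.
  transitivity (cinner (A k) u); last by apply/eqP; move: kK; rewrite inE.
  rewrite /cinner [in RHS](bigD1 j0) //=; congr (_ + _); apply: eq_bigr => i ne.
  by rewrite zs zu /sl (negPf ne) andbF.
rewrite mulrN opprK.
have -> : rho%:C * (u j0)^* * ((A k j0)^* * u j0) = rho%:C * (u j0)^* * u j0 * (A k j0)^*.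
  by ring.
by rewrite rhoE mul1r conjcK.
Qed.

Theorem theorem3p6 (R : realType) (m d s : nat) :
  (4 * s + 1 <= m)%N ->
  Cgeneric (fun M : 'M[R[i]]_(m, d.+1) => sparse_affine_PR s (Apart M) (bpart M)).
Proof.
move=> le_sm; have m0 : (0 < m)%N by apply: leq_trans le_sm; rewrite addn1.
pose i0 : 'I_m * 'I_d.+1 * bool := (Ordinal m0, ord0, true).
(* The discrete data, finite in number. For [d = 0] there are none, and injectivity is trivial. *)
pose cases : finType :=
  ({ffun 'I_s -> 'I_d} * {ffun 'I_s -> 'I_d} * {set 'I_m} * 'I_m * 'I_d)%type.
pose f (t : cases) (i : 'I_m * 'I_d.+1 * bool) (z : params m d s -> R) :=
  let: (sg, ta, K, k0, j0) := t in mx_coords (par_mx sg ta K k0 j0 z) i.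
have [U [oU dU nU HU]] : Rgeneric (fun w => forall t z, w <> (fun i => f t i z)).
  apply: (Rgeneric_forall i0) => -[[[[sg ta] K] k0] j0].
  apply: (Rgeneric_avoid_polyfun i0) => [|i]; first exact: card_params.
  exact: polyfun_par_coords.
exists U; split=> // M UM; apply: contrapT => bad.
have [sg [ta [K [k0 [j0 [z defM]]]]]] := non_injective_parametrized m0 bad.
by apply: (HU _ UM (sg, ta, K, k0, j0) z); rewrite {1}defM.
Qed.
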